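(* Let $R=R_1\times R_2\times\cdots\times R_s$ with $s\ge 1$, where each $R_i$ is a finite local ring with maximal ideal $M_i$ of order $m_i$, and where $|R_1|/m_1\le |R_2|/m_2\le\cdots\le |R_s|/m_s$. Then the energy of the line graph of $G_R$ is $$E(\mathcal{L}(G_R))=\begin{cases}2^{s+1}(|R^\times|-1)^2, & \text{if } 2=|R_1|/m_1=\cdots=|R_s|/m_s, \text{ or } R\cong\underbrace{\mathbb{F}_2\times\cdots\times\mathbb{F}_2}_{s-1}\times\mathbb{F}_3;\\[2pt] 2^{t+1}+2|R|(|R^\times|-2), & \text{if } 2=|R_1|/m_1=\cdots=|R_t|/m_t<|R_{t+1}|/m_{t+1} \text{ for some } 1\le t<s,\ \text{and } R\not\cong\underbrace{\mathbb{F}_2\times\cdots\times\mathbb{F}_2}_{s-1}\times\mathbb{F}_3;\\[2pt] 2|R|(|R^\times|-2), & \text{if } 3\le |R_1|/m_1 \text{ and } R\not\cong\mathbb{F}_3.\end{cases}$$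
   Context: Rings are commutative with identity $1\neq 0$. For a finite commutative ring $R$, $R^\times$ denotes its group of units. The unitary Cayley graph $G_R$ is the graph with vertex set $R$ in which $x,y\in R$ are adjacent iff $x-y\in R^\times$. A local ring is a commutative ring with a unique maximal ideal. $\mathbb{F}_q$ is the finite field with $q$ elements. The line graph $\mathcal{L}(G)$ of a graph $G$ has the edges of $G$ as vertices, two being adjacent iff they share an end-vertex. The energy $E(G)$ of a graph $G$ is the sum of the absolute values of the eigenvalues (with multiplicity) of its adjacency matrix. *)

(* Defs.v *)
From HB Require Import structures.
From mathcomp Require Import all_boot all_order all_fingroup all_algebra all_field.

Set Implicit Arguments.
Unset Strict Implicit.
Unset Printing Implicit Defensive.

Import GRing.Theory.
Local Open Scope ring_scope.

(* The library has no ring structure on dependent products. The index type is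
   'I_n.+1 so that the product is a nonzero ring. *)
Definition prod_ring (n : nat) (R : 'I_n.+1 -> finComNzRingType) : Type :=
  {dffun forall i : 'I_n.+1, R i}.

Section ProdRing.
Variables (n : nat) (R : 'I_n.+1 -> finComNzRingType).
Implicit Types f g h : prod_ring R.

HB.instance Definition _ := Finite.copy (prod_ring R)
  {dffun forall i : 'I_n.+1, R i}.

Definition prod_zero : prod_ring R := [ffun i => 0 : R i].
Definition prod_one : prod_ring R := [ffun i => 1 : R i].
Definition prod_opp f : prod_ring R := [ffun i => - f i].
Definition prod_add f g : prod_ring R := [ffun i => f i + g i].
Definition prod_mul f g : prod_ring R := [ffun i => f i * g i].

Fact prod_addA : associative prod_add.
Proof. by move=> f g h; apply/ffunP=> i; rewrite !ffunE addrA. Qed.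
Fact prod_addC : commutative prod_add.
Proof. by move=> f g; apply/ffunP=> i; rewrite !ffunE addrC. Qed.
Fact prod_add0 : left_id prod_zero prod_add.
Proof. by move=> f; apply/ffunP=> i; rewrite !ffunE add0r. Qed.
Fact prod_addN : left_inverse prod_zero prod_opp prod_add.
Proof. by move=> f; apply/ffunP=> i; rewrite !ffunE addNr. Qed.

HB.instance Definition _ := GRing.isZmodule.Build (prod_ring R)
  prod_addA prod_addC prod_add0 prod_addN.

Fact prod_mulA : associative prod_mul.
Proof. by move=> f g h; apply/ffunP=> i; rewrite !ffunE mulrA. Qed.
Fact prod_mulC : commutative prod_mul.
Proof. by move=> f g; apply/ffunP=> i; rewrite !ffunE mulrC. Qed.
Fact prod_mul1 : left_id prod_one prod_mul.
Proof. by move=> f; apply/ffunP=> i; rewrite !ffunE mul1r. Qed.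
Fact prod_mulD : left_distributive prod_mul prod_add.
Proof. by move=> f g h; apply/ffunP=> i; rewrite !ffunE mulrDl. Qed.
Fact prod_one_neq0 : prod_one != 0.
Proof. by apply/eqP=> /ffunP/(_ ord0)/eqP; rewrite !ffunE oner_eq0. Qed.

HB.instance Definition _ := GRing.Zmodule_isComNzRing.Build (prod_ring R)
  prod_mulA prod_mulC prod_mul1 prod_mulD prod_one_neq0.

(* Units of a finite ring: the elements having a two-sided inverse. *)
HB.instance Definition _ := FinRing.isNzRing.Build (prod_ring R).

End ProdRing.

Definition ring_iso (A B : nzRingType) : Prop :=
  exists f : {rmorphism A -> B}, bijective f.

(* F_2 x ... x F_2 x F_3 with n copies of F_2. *)
Definition F2s_F3 (n : nat) : finComUnitRingType :=
  prod_ring (fun i : 'I_n.+1 =>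
    if i == ord_max then 'F_3 : finComNzRingType else 'F_2 : finComNzRingType).

(* idealr_closed requires 1 \notin I, so it describes proper ideals. *)
Definition maximal_ideal (R : finComNzRingType) (M : {set R}) : Prop :=
  idealr_closed M /\
  forall I : {set R}, idealr_closed I -> M \subset I -> I = M.

Definition local_ring_with (R : finComNzRingType) (M : {set R}) : Prop :=
  maximal_ideal M /\ forall I : {set R}, maximal_ideal I -> I = M.

Definition unitary_cayley_graph (R : finComUnitRingType) : rel R :=
  fun x y => x - y \is a GRing.unit.
Arguments unitary_cayley_graph : clear implicits.

(* Graphs are symmetric irreflexive relations; edges are unordered pairs. *)
Definition edges (T : finType) (e : rel T) : {set {set T}} :=
  [set [set x; y] | x in T, y in T & e x y].

Definition edge_type (T : finType) (e : rel T) : finType :=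
  {E : {set T} | E \in edges e}.

Definition line_graph (T : finType) (e : rel T) : rel (edge_type e) :=
  fun E F => (E != F) && (val E :&: val F != set0).
Arguments line_graph {T} e.

Definition adjacency_mx (T : finType) (e : rel T) : 'M[algC]_#|T| :=
  \matrix_(i, j) (e (enum_val i) (enum_val j))%:R.

(* The eigenvalues with multiplicity: the roots of the characteristic
   polynomial, which splits over algC. *)
Definition spectrum (n : nat) (A : 'M[algC]_n) : seq algC :=
  sval (closed_field_poly_normal (char_poly A)).

Definition energy (T : finType) (e : rel T) : algC :=
  \sum_(z <- spectrum (adjacency_mx e)) `|z|.

(* Main.v *)
(** The line graph of a [d]-regular graph with [N] vertices and eigenvalues
[lam] has eigenvalues [lam + d - 2], together with [-2] repeated [N d / 2 - N]
times, so its energy is [sum |lam + d - 2| + N (d - 2)].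

The adjacency matrix of [G_R] is the tensor product of those of the local
factors.  For a local ring with residue field of order [q] and maximal ideal of
order [m] the graph is complete multipartite; from [A^2 + m A = (q - 1) m J] and
the traces of [A] and [A^2] its eigenvalues are [(q - 1) m] (once), [- m]
([q - 1] times) and [0].  Hence an eigenvalue of [G_R] is either [+- d] or at
most [d / 2] in absolute value.  For [d >= 3] the quantity [lam + d - 2] is
therefore negative only when [lam = - d], and the energy follows by counting
these eigenvalues; the cases [d = 1] and [d = 2] are immediate, and [d = 2] with
a residue field of order at least 3 forces [F_2 x ... x F_2 x F_3]. *)

Require Import Defs.
From HB Require Import structures.
From mathcomp Require Import all_boot all_order all_fingroup all_algebra all_field.
From mathcomp Require Import ring zify.
Import GRing.Theory.
Local Open Scope ring_scope.
Import Num.Theory.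

Set Implicit Arguments.
Unset Strict Implicit.
Unset Printing Implicit Defensive.

(** * Line graphs of regular graphs *)

(** Sylvester's determinant identity. Multiplying the block matrix [F] by a block triangular matrix,
    on the right or on the left, produces either determinant up to a power of [y]. *)
Lemma det_sub_mulmxC (K : comNzRingType) m n (B : 'M[K]_(m, n)) (C : 'M[K]_(n, m)) (y : K) :
  y ^+ n * \det (y%:M - B *m C) = y ^+ m * \det (y%:M - C *m B).
Proof.
pose F := block_mx y%:M B C 1%:M.
have E1 : F *m block_mx 1%:M 0 (- C) 1%:M = block_mx (y%:M - B *m C) B 0 1%:M.
  rewrite mulmx_block !mulmx1 !mulmx0 !add0r mul1mx subrr mulmxN.
  by [].
have E2 : block_mx 1%:M 0 (- C) y%:M *m F = block_mx y%:M B 0 (y%:M - C *m B).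
  rewrite mulmx_block !mul1mx !mul0mx !addr0 mulmx1 !mulNmx.
  by rewrite -scalar_mxC addNr addrC.
move/(congr1 determinant): E1; rewrite det_mulmx det_lblock det_ublock !det1 !mulr1 => <-.
move/(congr1 determinant): E2; rewrite det_mulmx det_lblock det_ublock !det1 !det_scalar mul1r.
by [].
Qed.

(** This is [K = P diag(lam) Q] with [P Q = 1]. Kernels indexed by [T] itself, rather than by
    ordinals, allow tensor products to be formed pointwise; integer eigenvalues keep the later
    estimates in linear integer arithmetic. *)
Definition diagonalizes (T : finType) (K : T -> T -> algC) (lam : T -> int) : Prop :=
  exists P Q : T -> T -> algC,
    (forall x z, \sum_y P x y * Q y z = (x == z)%:R) /\
    (forall x z, K x z = \sum_y P x y * (lam y)%:~R * Q y z).

Lemma sum_ord_enum_val (T : finType) (V : nmodType) (F : T -> V) :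
  \sum_(i < #|T|) F (enum_val i) = \sum_x F x.
Proof. by rewrite [RHS](reindex (@enum_val T T)) //; apply: onW_bij; exact: enum_val_bij. Qed.

(** The polynomial [y] stays general because the line graph calls for ['X + 2 - d] in place of
    ['X]. *)
Lemma det_sub_diagonalized (T : finType) (K : T -> T -> algC) (lam : T -> int)
    (y : {poly algC}) :
  diagonalizes K lam ->
  \det (y%:M - map_mx polyC (\matrix_(i < #|T|, j < #|T|) K (enum_val i) (enum_val j)))
    = \prod_x (y - (lam x)%:~R%:P).
Proof.
case=> P [Q [PQ KE]].
pose mx (F : T -> T -> algC) : 'M[algC]_#|T| :=
  \matrix_(i, j) F (enum_val i) (enum_val j).
pose D : 'rV[algC]_#|T| := \row_j (lam (enum_val j))%:~R.
have PQ1 : mx P *m mx Q = 1%:M.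
  apply/matrixP=> i j; rewrite !mxE; under eq_bigr do rewrite !mxE.
  by rewrite (sum_ord_enum_val (fun z => P _ z * Q z _)) PQ (inj_eq enum_val_inj).
have KE1 : mx K = mx P *m diag_mx D *m mx Q.
  apply/matrixP=> i j; rewrite mul_mx_diag !mxE; under eq_bigr do rewrite !mxE.
  by rewrite (sum_ord_enum_val (fun z => P _ z * (lam z)%:~R * Q z _)) KE.
pose f := map_mx (@polyC algC).
have E : y%:M - f _ _ (mx K) = f _ _ (mx P) *m (y%:M - f _ _ (diag_mx D)) *m f _ _ (mx Q).
  rewrite KE1 /f !map_mxM mulmxBr mulmxBl scalar_mxC -!mulmxA; congr (_ - _).
  by rewrite -map_mxM PQ1 map_mx1 mulmx1.
rewrite -/(mx K) -/(f _ _ (mx K)) E !det_mulmx mulrAC -det_mulmx -map_mxM PQ1 map_mx1 det1 mul1r.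
have -> : y%:M - f _ _ (diag_mx D) = diag_mx (\row_j (y - (D 0 j)%:P)).
  by apply/matrixP=> i j; rewrite !mxE; case: eqP => [->|]; rewrite ?mulr1n ?mulr0n ?polyC0 ?subr0.
rewrite det_diag [RHS](reindex (@enum_val T T)) /=; last by apply: onW_bij; exact: enum_val_bij.
by apply: eq_bigr => j _; rewrite !mxE.
Qed.

Lemma sum_natb (T : finType) (V : pzSemiRingType) (P : pred T) :
  \sum_x (P x)%:R = #|[set x | P x]|%:R :> V.
Proof.
rewrite -sum1_card natr_sum big_mkcond [RHS]big_mkcond.
by apply: eq_bigr => x _; rewrite inE; case: (P x).
Qed.

Section LineGraph.
Variables (T : finType) (e : rel T).
Hypotheses (e_sym : symmetric e) (e_irr : irreflexive e).

Lemma edgesP (E : {set T}) :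
  reflect (exists x y, e x y /\ E = [set x; y]) (E \in edges e).
Proof.
apply: (iffP imset2P) => [[x y _]|[x [y [exy ->]]]].
  by rewrite inE => /andP[_ exy] ->; exists x, y.
by exists x y; rewrite ?inE.
Qed.

Lemma edge_neq x y : e x y -> x != y.
Proof. by apply: contraTneq => ->; rewrite e_irr. Qed.

Lemma card_edge (E : edge_type e) : #|val E| = 2%N.
Proof.
by have /edgesP[x [y [exy ->]]] := valP E; rewrite cards2 edge_neq.
Qed.

Lemma edge_eq2 (E : {set T}) x y : E \in edges e -> x != y ->
  x \in E -> y \in E -> E = [set x; y] /\ e x y.
Proof.
case/edgesP=> a [b [eab ->]]; rewrite !inE => nxy.
case/orP=> /eqP Ex; case/orP=> /eqP Ey; subst.
- by rewrite eqxx in nxy.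
- by [].
- by rewrite setUC e_sym.
- by rewrite eqxx in nxy.
Qed.

(** The map sending [y] to [[set x; y]] is injective on the neighbours of [x], and its image is the
    set of edges at [x]. *)
Lemma card_edges_at x : #|[set E in edges e | x \in E]| = #|[set y | e x y]|.
Proof.
rewrite -(card_in_imset (f := fun y => [set x; y]) (D := [set y | e x y])).
  apply: eq_card => E; rewrite inE; apply/andP/imsetP.
    case=> /edgesP[a [b [eab ->]]]; rewrite !inE => /orP[]/eqP ->.
      by exists b; rewrite ?inE.
    by exists a; rewrite ?inE 1?e_sym // setUC.
  case=> y; rewrite inE => exy ->; split; last by rewrite !inE eqxx.
  by apply/edgesP; exists x, y.
move=> y z; rewrite !inE => exy exz /setP/(_ y).
by rewrite !inE eqxx orbT eq_sym (negPf (edge_neq exy)) => /esym/eqP.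
Qed.

(** An entry of [B B^T] for the incidence matrix [B]: distinct vertices lie together on at most one
    edge. *)
Lemma sum_edges_common x y :
  \sum_(E : edge_type e) (x \in val E)%:R * (y \in val E)%:R =
  (if x == y then #|[set z | e x z]| else e x y)%:R :> algC.
Proof.
under eq_bigr do rewrite -natrM mulnb.
rewrite -(big_sub (edges e) (fun E => ((x \in E) && (y \in E))%:R)) big_mkcond /=.
under eq_bigr do rewrite -mulrb -mulrnA mulnb.
rewrite sum_natb; congr (_%:R); have [<-|nxy] := eqVneq x y.
  by rewrite -card_edges_at; apply: eq_card => E; rewrite !inE andbb andbC.
have [exy|nexy] := boolP (e x y); last first.
  apply/eqP; rewrite cards_eq0; apply/eqP/setP=> E; rewrite !inE.
  apply/negP=> /andP[/andP[xE yE] EE].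
  by have [_] := edge_eq2 EE nxy xE yE; apply/negP.
rewrite -[RHS]/1%N -(cards1 [set x; y]); apply: eq_card => E; rewrite !inE.
apply/andP/eqP=> [[/andP[xE yE] EE]|->].
  by have [] := edge_eq2 EE nxy xE yE.
by rewrite !inE !eqxx orbT; split=> //; apply/edgesP; exists x, y.
Qed.

(** An entry of [B^T B]: distinct edges share at most one vertex, since sharing two would make them
    equal. *)
Lemma sum_vertices_common (E F : edge_type e) :
  \sum_x (x \in val E)%:R * (x \in val F)%:R =
  (line_graph e E F)%:R + (E == F)%:R *+ 2 :> algC.
Proof.
under eq_bigr do rewrite -natrM mulnb.
rewrite sum_natb -mulrnA -natrD; congr (_%:R).
have -> : #|[set x | (x \in val E) && (x \in val F)]| = #|val E :&: val F|.
  by apply: eq_card => x; rewrite !inE.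
rewrite /line_graph; have [<-|nEF] := eqVneq E F; first by rewrite setIid card_edge.
rewrite addn0 -card_gt0 /=.
have : (#|val E :&: val F| < 2)%N.
  rewrite ltnNge; apply: contra nEF => le2.
  have EI : val E :&: val F = val E.
    by apply/eqP; rewrite eqEcard subsetIl card_edge.
  have FI : val E :&: val F = val F.
    by apply/eqP; rewrite eqEcard subsetIr card_edge.
  by apply/eqP/val_inj; rewrite -EI FI.
by case: #|_| => [|[|]].
Qed.

Variables (d : nat) (lam : T -> int).
Hypothesis e_reg : forall x, #|[set y | e x y]| = d.

(** Double counting of the incident pairs of a vertex and an edge. *)
Lemma handshake : (2 * #|edge_type e| = #|T| * d)%N.
Proof.
have : (\sum_(x : T) \sum_(E : edge_type e) (x \in val E) = #|T| * d)%N.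
  rewrite -sum_nat_const; apply: eq_bigr => x _; rewrite -(e_reg x) -card_edges_at.
  rewrite -(big_sub (edges e) (fun E => (x \in E) : nat)) -sum1_card [RHS]big_mkcond [LHS]big_mkcond.
  by apply: eq_bigr => E _; rewrite !inE; case: (E \in _); case: (x \in E).
rewrite exchange_big /= => <-; rewrite mulnC -sum_nat_const; apply: eq_big => // E _.
by rewrite -(card_edge E) -sum1_card big_mkcond; apply: eq_bigr => x _; case: (x \in _).
Qed.

(* With [B] the incidence matrix, [B B^T = A + d] and [B^T B = L + 2]. *)
Lemma char_poly_line_graph : diagonalizes (fun x y => (e x y)%:R) lam ->
  ('X + 2) ^+ #|edge_type e| * \prod_x ('X - (lam x + d%:Z - 2)%:~R%:P) =
  ('X + 2) ^+ #|T| * char_poly (adjacency_mx (line_graph e)).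
Proof.
move=> diag_e.
pose B : 'M[algC]_(#|T|, #|edge_type e|) :=
  \matrix_(i, j) (@enum_val T T i \in val (@enum_val (edge_type e) (edge_type e) j))%:R.
have BBt : B *m B^T = adjacency_mx e + d%:R%:M.
  apply/matrixP=> i j; rewrite !mxE; under eq_bigr do rewrite !mxE.
  rewrite (sum_ord_enum_val (fun E : edge_type e => (enum_val i \in val E)%:R * (enum_val j \in val E)%:R)).
  rewrite sum_edges_common (inj_eq enum_val_inj); have [->|_] := eqVneq i j.
    by rewrite e_irr e_reg add0r.
  by rewrite mulr0n addr0.
have BtB : B^T *m B = adjacency_mx (line_graph e) + 2%:M.
  apply/matrixP=> i j; rewrite !mxE; under eq_bigr do rewrite !mxE.
  rewrite (sum_ord_enum_val (fun x => (x \in val (enum_val i))%:R * (x \in val (enum_val j))%:R)).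
  by rewrite sum_vertices_common (inj_eq enum_val_inj) mulrnAC.
(* At [y = 'X + 2] the shift by 2 cancels on the edge side, leaving the characteristic matrix of the
   line graph; the vertex side becomes ['X + 2 - d] minus the adjacency matrix. *)
have := det_sub_mulmxC (map_mx polyC B) (map_mx polyC B^T) ('X + 2).
rewrite -!map_mxM BBt BtB !map_mxD !map_scalar_mx /=.
have -> : ('X + 2)%:M - (map_mx polyC (adjacency_mx (line_graph e)) + (2%:P)%:M) =
   char_poly_mx (adjacency_mx (line_graph e)).
  by rewrite raddfD opprD addrACA polyC_natr subrr addr0.
have -> : ('X + 2)%:M - (map_mx polyC (adjacency_mx e) + (d%:R%:P)%:M) =
    ('X + 2 - d%:R%:P)%:M - map_mx polyC (adjacency_mx e) :> 'M_#|T|.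
  by rewrite [in RHS]raddfB opprD addrA addrAC.
rewrite (det_sub_diagonalized _ diag_e) => <-.
congr (_ * _); apply: eq_bigr => x _.
have -> : (lam x + d%:Z - 2)%:~R = (lam x)%:~R + d%:R - 2 :> algC by rewrite !rmorphB !rmorphD.
rewrite polyCB polyCD !polyC_natr.
by rewrite opprB opprD addrA [RHS]addrAC addrA.
Qed.

(** Both sides of [char_poly_line_graph] have the same multiset of roots. The roots [-2] are kept on
    both sides, as the number of edges may be smaller than [#|T|]; their contributions are compared
    only as absolute values, through [handshake]. *)
Lemma energy_line_graph : diagonalizes (fun x y => (e x y)%:R) lam ->
  energy (line_graph e) =
  (\sum_x `|lam x + d%:Z - 2| + #|T|%:Z * (d%:Z - 2))%:~R.
Proof.
move=> /char_poly_line_graph.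
rewrite /energy /spectrum; case: closed_field_poly_normal => r /=.
rewrite (monicP (char_poly_monic _)) scale1r => ->.
have -> : 'X + 2 = 'X - (-2)%:P :> {poly algC} by rewrite polyCN polyC_natr opprK.
rewrite -!prodr_const.
pose s1 : seq algC := nseq #|edge_type e| (-2 : algC) ++ [seq (lam x + d%:Z - 2)%:~R | x <- enum T].
pose s2 : seq algC := nseq #|T| (-2 : algC) ++ r.
have prod_nseq (I : finType) : \prod_(i in I) ('X - (-2)%:P) =
    \prod_(z <- nseq #|I| (-2 : algC)) ('X - z%:P).
  by rewrite prodr_const big_nseq iter_mulr mulr1.
rewrite !prod_nseq.
have -> : \prod_x ('X - (lam x + d%:Z - 2)%:~R%:P) =
   \prod_(z <- [seq (lam x + d%:Z - 2)%:~R | x <- enum T]) ('X - (z : algC)%:P).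
  by rewrite big_map big_enum.
move=> E; have E12 : perm_eq s1 s2.
  by apply: prod_XsubC_eq; rewrite !big_cat.
have : \sum_(z <- s1) `|z| = \sum_(z <- s2) `|z| by apply: perm_big.
rewrite !big_cat /=.
rewrite !big_nseq !iter_addr !addr0 normrN normr_nat big_map big_enum /=.
move=> sumE; apply: (addrI (2 *+ #|T|)); rewrite -sumE.
have -> : 2 *+ #|edge_type e| = (#|T| * d)%:R :> algC by rewrite -handshake natrM mulr_natr.
rewrite rmorphD rmorph_sum /= addrCA [RHS]addrC; congr (_ + _).
  rewrite intrM intrB natrM -[2 *+ _]mulr_natr mulrBr [2 * _]mulrC.
  by rewrite addrC subrK.
by apply: eq_bigr => x _; rewrite intr_norm.
Qed.

End LineGraph.

(** * Complete multipartite graphs *)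

Lemma sum_ord_enum_rank (T : finType) (V : nmodType) (F : 'I_#|T| -> V) :
  \sum_x F (enum_rank x) = \sum_i F i.
Proof.
rewrite [RHS](reindex (@enum_rank T)) //.
by apply: onW_bij; exists enum_val; [exact: enum_rankK | exact: enum_valK].
Qed.

(** Distributivity for dependent families, carried over from [fprod]. It factors every sum over the
    product ring into sums over the components. *)
Lemma big_dffun_distr (V : pzSemiRingType) (I : finType) (T_ : I -> finType)
    (F : forall i, T_ i -> V) :
  \sum_(f : {dffun forall i, T_ i}) \prod_i F i (f i) = \prod_i \sum_x F i x.
Proof.
rewrite (reindex (@dffun_of_fprod I T_)); last exact/onW_bij/dffun_of_fprod_bij.
transitivity (\sum_(f : fprod T_) \prod_(i in I) [ffun x => F i x] (f i)).
  by apply: eq_bigr => f _; apply: eq_bigr => i _; rewrite !ffunE.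
rewrite big_fprod.
transitivity (\prod_i \sum_(j in tagged_with T_ i) untag 0 [ffun x => F i x] j).
  by rewrite bigA_distr_big_dep.
apply: eq_bigr => i _; rewrite -(big_tag (fun i => [ffun x => F i x])).
by apply: eq_bigr => x _; rewrite ffunE.
Qed.

Section CompleteMultipartite.
Variables (T : finType) (e : rel T) (m D : nat).
Hypotheses (e_sym : symmetric e) (e_irr : irreflexive e).
Hypotheses (m_gt0 : (0 < m)%N) (D_gt0 : (0 < D)%N) (cardT : #|T| = (m + D)%N).
Hypothesis e_reg : forall x, #|[set y | e x y]| = D.
Hypothesis e_sqr : forall x y, (#|[set z | e x z && e z y]| + m * e x y = D)%N.

Let A := adjacency_mx e.
Let J : 'M[algC]_#|T| := const_mx 1.

Let mulAJ : A *m J = D%:R *: J.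
Proof.
apply/matrixP=> i j; rewrite !mxE; under eq_bigr do rewrite !mxE mulr1.
by rewrite (sum_ord_enum_val (fun z => (e _ z)%:R)) sum_natb e_reg mulr1.
Qed.

Let mulAA : A *m A + m%:R *: A = D%:R *: J.
Proof.
apply/matrixP=> i j; rewrite !mxE; under eq_bigr do rewrite !mxE -natrM mulnb.
rewrite (sum_ord_enum_val (fun z => (e _ z && e z _)%:R)) sum_natb.
by rewrite -natrM -natrD e_sqr mulr1.
Qed.

Let A_normal : A \is normalmx.
Proof.
apply: hermitian_normalmx; apply: realsym_hermsym.
  by apply/eqP; rewrite expr0 scale1r; apply/matrixP=> i j; rewrite !mxE e_sym.
by apply/mxOverP=> i j; rewrite mxE realn.
Qed.

(** [mulAA] and [mulAJ] give [(A - D)(A + m)A = 0], so only [D], [- m] and 0 can be eigenvalues. The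
    traces of [A] and [A^2] then fix the multiplicities of [D] and [- m]. The sum over an arbitrary
    [F] vanishing at 0 records these multiplicities. *)
Lemma complete_multipartite_spectrum : exists lam : T -> int,
  [/\ diagonalizes (fun x y => (e x y)%:R) lam,
      forall x, lam x \in [:: D%:Z; - m%:Z; 0]
    & forall (b : nat) (F : int -> int), F 0 = 0 -> (b * m)%N = D ->
        \sum_x F (lam x) = F D%:Z + F (- m%:Z) * b%:Z].
Proof.
pose P := spectralmx A; pose sp := spectral_diag A; pose S := diag_mx sp.
have Punit : P \in unitmx by exact: spectral_unit.
have AE : A = invmx P *m S *m P by exact/orthomx_spectralP.
have SP : S *m P = P *m A by rewrite AE !mulmxA mulmxV // mul1mx.
have cubic : A *m (A *m A) + m%:R *: (A *m A) = D%:R *: (A *m A) + (D * m)%:R *: A.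
  have : A *m (A *m A + m%:R *: A) = D%:R *: (A *m A + m%:R *: A).
    by rewrite mulAA -scalemxAr mulAJ.
  by rewrite mulmxDr -scalemxAr scalerDr scalerA natrM.
have S2P : S *m S *m P = P *m (A *m A) by rewrite -mulmxA SP mulmxA SP mulmxA.
have S3P : S *m S *m S *m P = P *m (A *m (A *m A)).
  by rewrite -(mulmxA (S *m S)) SP (mulmxA (S *m S)) S2P -!mulmxA.
(* Conjugation by the spectral basis moves the cubic relation to the diagonal matrix [S], where it
   is read entry by entry. *)
have cubicS : S *m S *m S + m%:R *: (S *m S) = D%:R *: (S *m S) + (D * m)%:R *: S.
  apply: (can_inj (mulmxK Punit)).
  rewrite !mulmxDl -!scalemxAl S2P S3P SP.
  by move/(congr1 (mulmx P)): cubic; rewrite !mulmxDr -!scalemxAr.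
have S2E : S *m S = diag_mx (\row_j (sp 0 j * sp 0 j)) by rewrite mulmx_diag.
have sp3 j : (sp 0 j == D%:R) || (sp 0 j == - m%:R) || (sp 0 j == 0).
  move/matrixP/(_ j j): cubicS; rewrite S2E mulmx_diag !mxE eqxx !mulr1n natrM.
  move=> E; rewrite -subr_eq0 -[_ == - _]subr_eq0 opprK -!mulf_eq0.
  move/eqP: E; rewrite -subr_eq0 => /eqP E; apply/eqP; rewrite -[RHS]E; ring.
pose lam x : int := if sp 0 (enum_rank x) == D%:R then D%:Z else
  if sp 0 (enum_rank x) == - m%:R then - m%:Z else 0.
have lamE x : (lam x)%:~R = sp 0 (enum_rank x).
  rewrite /lam; have := sp3 (enum_rank x).
  case: eqP => [->//|_]; case: eqP => [->|_ /eqP ->//]; by rewrite rmorphN.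
have lam3 x : lam x \in [:: D%:Z; - m%:Z; 0].
  by rewrite /lam !inE; do 2![case: ifP => _; rewrite ?eqxx ?orbT //].
have trSim (X Y : 'M[algC]_#|T|) : Y *m P = P *m X -> \tr X = \tr Y.
  by move=> E; rewrite -[Y](mulmxK Punit) E -mulmxA mxtrace_mulC mulmxKV.
have sumlam : \sum_x lam x = 0.
  apply: (@intr_inj algC); rewrite rmorph_sum /=.
  under eq_bigr do rewrite lamE.
  rewrite (sum_ord_enum_rank (fun j => sp 0 j)) -mxtrace_diag -(trSim _ _ SP).
  by rewrite /mxtrace big1 // => i _; rewrite mxE e_irr.
have sumlam2 : \sum_x lam x ^+ 2 = (D * #|T|)%:Z.
  apply: (@intr_inj algC); rewrite rmorph_sum /=.
  under eq_bigr do rewrite rmorphXn /= lamE expr2.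
  rewrite (sum_ord_enum_rank (fun j => sp 0 j * sp 0 j)).
  have -> : \sum_j sp 0 j * sp 0 j = \tr (A *m A).
    by rewrite (trSim _ _ S2P) S2E mxtrace_diag; apply: eq_bigr => j _; rewrite mxE.
  have -> : A *m A = D%:R *: J - m%:R *: A by rewrite -mulAA addrK.
  rewrite /mxtrace (eq_bigr (fun=> D%:R)) => [|i _]; last by rewrite !mxE e_irr mulr0 subr0 mulr1.
  by rewrite sumr_const card_ord -mulrnA.
pose a := #|[set x | lam x == D%:Z]|; pose b := #|[set x | lam x == - m%:Z]|.
have split (F : int -> int) : F 0 = 0 -> \sum_x F (lam x) = F D%:Z * a%:Z + F (- m%:Z) * b%:Z.
  move=> F0; rewrite -[a%:Z]natz -[b%:Z]natz /a /b -!sum_natb !mulr_sumr -big_split /=.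
  apply: eq_bigr => x _; have nD : - m%:Z == D%:Z = false by apply/eqP; lia.
  have := lam3 x; rewrite !inE => /or3P[]/eqP ->; rewrite ?eqxx ?nD.
  - by rewrite eq_sym nD mulr0 addr0 mulr1.
  - by rewrite mulr0 add0r mulr1.
  - have -> : 0 == D%:Z = false by apply/eqP; lia.
    have -> : 0 == - m%:Z = false by apply/eqP; lia.
    by rewrite F0 !mulr0 addr0.
(* With multiplicities [a] of [D] and [b] of [- m], the traces say [a D = b m] and
   [a D^2 + b m^2 = D (m + D)]. Substituting the first into the second gives
   [a D (D + m) = D (m + D)], hence [a = 1]. *)
have := split id erefl; rewrite sumlam => Ea.
have := split (fun z => z ^+ 2) erefl; rewrite sumlam2 cardT => Eb.
have Ea' : (b * m = a * D)%N by nia.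
have a1 : a = 1%N by nia.
exists lam; split=> //; last first.
  move=> c F F0 cE; rewrite (split F F0) a1 mulr1; congr (_ + _ * _%:Z); nia.
exists (fun x y => invmx P (enum_rank x) (enum_rank y)), (fun x y => P (enum_rank x) (enum_rank y)).
split=> x z.
  rewrite (sum_ord_enum_rank (fun j => invmx P _ j * P j _)).
  by have /matrixP/(_ (enum_rank x) (enum_rank z)) := mulVmx Punit; rewrite !mxE (inj_eq enum_rank_inj).
under eq_bigr do rewrite lamE.
rewrite (sum_ord_enum_rank (fun j => invmx P _ j * sp 0 j * P j _)).
have /matrixP/(_ (enum_rank x) (enum_rank z)) := AE; rewrite mul_mx_diag !mxE !enum_rankK => ->.
by apply: eq_bigr => j _; rewrite !mxE.
Qed.
End CompleteMultipartite.

(** * Local rings *)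

(** The factors carry no unit structure, so units are described by the existence of an inverse; one
    side suffices by commutativity. *)
Definition invertible (R : finComNzRingType) (x : R) : bool := [exists y, x * y == 1].

Lemma invertibleP (R : finComNzRingType) (x : R) :
  reflect (exists y, x * y = 1) (invertible x).
Proof. by apply: (iffP existsP) => [[y /eqP]|[y /eqP]]; exists y. Qed.

Section LocalRing.
Variables (R : finComNzRingType) (M : {set R}).
Hypothesis M_local : local_ring_with M.

(** A boolean form of [idealr_closed], to which [maxset_exists] applies. *)
Let idealb (I : {set R}) := [&& 0 \in I, 1 \notin I &
  [forall a, forall u, forall v, (u \in I) ==> (v \in I) ==> (a * u + v \in I)]].

Let idealP (I : {set R}) : reflect (idealr_closed I) (idealb I).
Proof.
apply: (iffP and3P) => [[I0 I1 /forallP aI]|[I0 I1 aI]]; split=> //.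
  move=> a u v uI vI; have /forallP/(_ u)/forallP/(_ v) := aI a.
  by rewrite uI vI.
apply/forallP=> a; apply/forallP=> u; apply/forallP=> v.
by apply/implyP=> uI; apply/implyP=> vI; apply: aI.
Qed.

Let M0 : 0 \in M. Proof. by have [[[]]] := M_local. Qed.
Let M1 : 1 \notin M. Proof. by have [[[]]] := M_local. Qed.
Let Mlin a u v : u \in M -> v \in M -> a * u + v \in M.
Proof. by have [[[_ _ H] _] _] := M_local; apply: H. Qed.

Let MD u v : u \in M -> v \in M -> u + v \in M.
Proof. by move=> uM vM; have := Mlin 1 uM vM; rewrite mul1r. Qed.

Let MN u : (- u \in M) = (u \in M).
Proof.
have N v : v \in M -> - v \in M.
  by move=> vM; have := Mlin (-1) vM M0; rewrite mulN1r addr0.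
by apply/idP/idP => /N; rewrite ?opprK.
Qed.

Let MBl u v : u \in M -> (u + v \in M) = (v \in M).
Proof.
move=> uM; apply/idP/idP=> [uvM|]; last exact: MD.
by rewrite -[v](addKr u); apply: MD; rewrite ?MN.
Qed.

(** If [x] is not invertible, the ideal [xR] is proper and extends to a maximal ideal, which is [M]
    by uniqueness. Conversely, an inverse of an element of [M] would put 1 in [M]. *)
Lemma local_invertible x : invertible x = (x \notin M).
Proof.
apply/invertibleP/idP=> [[y xy1]|].
  by apply: contra M1 => xM; have := Mlin y xM M0; rewrite mulrC xy1 addr0.
move=> xM; apply/invertibleP; apply: contraNT xM => nux.
pose I := [set x * y | y : R].
have /maxset_exists[I' /maxsetP[/idealP I'id I'max] II'] : idealb I.
  apply/and3P; split; first by apply/imsetP; exists 0; rewrite ?mulr0.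
    by apply: contra nux => /imsetP[y _ xy]; apply/invertibleP; exists y.
  apply/forallP=> a; apply/forallP=> u; apply/forallP=> v.
  apply/implyP=> /imsetP[y _ ->]; apply/implyP=> /imsetP[z _ ->].
  by apply/imsetP; exists (a * y + z); rewrite // mulrDr mulrCA.
have <- : I' = M.
  have [_ uniqM] := M_local; apply: uniqM; split=> // L /idealP; exact: I'max.
by apply: (subsetP II'); apply/imsetP; exists 1; rewrite ?mulr1.
Qed.

Lemma local_card_gt0 : (0 < #|M|)%N.
Proof. by apply/card_gt0P; exists 0. Qed.

(** Lagrange's theorem for the additive subgroup [M]. *)
Lemma local_card : #|R| = (#|R| %/ #|M| * #|M|)%N.
Proof.
have gM : group_set M.
  apply/group_setP; split; first exact: M0.
  by move=> u v; exact: MD.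
have := cardSg (subsetT (Group gM)); rewrite cardsT /= => dvdM.
by rewrite divnK.
Qed.

Lemma local_residue_gt1 : (1 < #|R| %/ #|M|)%N.
Proof.
have ltMR : (#|M| < #|R|)%N.
  rewrite -cardsT; apply: proper_card; apply/properP; split; first exact: subsetT.
  by exists 1; rewrite ?inE.
by rewrite ltnNge; apply: contraL ltMR => le1; rewrite -leqNgt {1}local_card -[leqRHS]mul1n leq_mul2r le1 orbT.
Qed.

Let q := (#|R| %/ #|M|)%N.
Let m := #|M|.

Lemma card_local_invertible : #|[set x : R | invertible x]| = (q.-1 * m)%N.
Proof.
have -> : [set x : R | invertible x] = ~: M by apply/setP=> x; rewrite !inE local_invertible.
have := cardsC M; have := local_card; have := local_residue_gt1; rewrite -/q -/m.
by case: (q) => // k _ ->; rewrite mulSn => /addnI.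
Qed.

Let e : rel R := fun x y => invertible (x - y).

Let card_coset x : #|[set z | x - z \in M]| = m.
Proof.
rewrite /m -(card_imset M (addrI x)); apply: eq_card => z; rewrite inE.
apply/idP/imsetP=> [xzM|[u uM ->]].
  by exists (z - x); rewrite ?subrKC // -MN opprB.
by rewrite opprD addNKr MN.
Qed.

(** Two elements are adjacent exactly when they lie in different cosets of [M], so the graph is
    complete multipartite with [q] parts of size [m]. *)
Lemma local_spectrum : exists lam : R -> int,
  [/\ diagonalizes (fun x y : R => (invertible (x - y))%:R) lam,
      forall x, lam x \in [:: (q.-1 * m)%:Z; - m%:Z; 0]
    & forall F : int -> int, F 0 = 0 ->
        \sum_x F (lam x) = F (q.-1 * m)%:Z + F (- m%:Z) * q.-1%:Z].
Proof.
have q1 := local_residue_gt1; have m0 := local_card_gt0.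
have Rqm := local_card; rewrite -/q -/m in q1 m0 Rqm.
have e_sym : symmetric e.
  by move=> x y; rewrite /e !local_invertible -MN opprB.
have e_irr : irreflexive e by move=> x; rewrite /e subrr local_invertible M0.
have cardT : #|R| = (m + q.-1 * m)%N by rewrite Rqm -mulSn prednK // ltnW.
have e_reg x : #|[set y | e x y]| = (q.-1 * m)%N.
  have := cardsC [set z | x - z \in M]; rewrite card_coset cardT => /addnI <-.
  by apply: eq_card => z; rewrite !inE /e local_invertible.
(* The common neighbours of [x] and [y] form the complement of their cosets. That removes [m]
   elements if the cosets coincide and [2 m] otherwise, where the term [m * e x y] compensates. *)
have e_sqr x y : (#|[set z | e x z && e z y]| + m * e x y = q.-1 * m)%N.
  pose S x := [set z | x - z \in M].
  have inS z : e x z && e z y = (z \in ~: (S x :|: S y)).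
    by rewrite !inE negb_or /e !local_invertible -(MN (z - y)) opprB.
  have -> : #|[set z | e x z && e z y]| = #|~: (S x :|: S y)|.
    by apply: eq_card => z; rewrite inE inS.
  have := cardsC (S x :|: S y); rewrite cardT cardsU !card_coset /e local_invertible.
  have zE z : y - z = - (x - y) + (x - z) by rewrite opprB addrA subrK.
  have [xyM|xyM] := boolP (x - y \in M).
    have -> : S y = S x by apply/setP=> z; rewrite !inE zE MBl ?MN.
    by rewrite setIid card_coset muln0 addn0 addnK => /addnI.
  have -> : S x :&: S y = set0.
    apply/setP=> z; rewrite !inE zE; apply/negP=> /andP[xzM].
    by rewrite addrC MBl // MN (negPf xyM).
  rewrite cards0 subn0 muln1 -addnA => /addnI <-; exact: addnC.
have [|lam [dl lam3 sl]] := complete_multipartite_spectrum e_sym e_irr m0 _ cardT e_reg e_sqr.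
  by rewrite muln_gt0 m0 andbT -ltnS prednK // ltnW.
by exists lam; split=> // F F0; apply: sl.
Qed.
End LocalRing.

(** * Products of spectra *)

(** The sign of an eigenvalue of largest modulus [d], and 0 for the others. Products of signs detect
    the eigenvalues of largest modulus of a tensor product. *)
Definition extremal (d : nat) (z : int) : int := (z == d%:Z)%:R - (z == - d%:Z)%:R.

Lemma extremal_full (d : nat) (z : int) : (0 < d)%N -> `|z| = d%:Z ->
  z = extremal d z * d%:Z /\ `|extremal d z| = 1.
Proof.
move=> d0 zd; rewrite /extremal; have [->|->] : z = d%:Z \/ z = - d%:Z by lia.
  by rewrite eqxx (_ : (d%:Z == - d%:Z) = false) ?subr0 ?mul1r //; apply/eqP; lia.
by rewrite eqxx (_ : (- d%:Z == d%:Z) = false) ?sub0r ?mulN1r //; apply/eqP; lia.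
Qed.

Lemma extremal_eq0 (d : nat) (z : int) : (0 < d)%N -> `|z| != d%:Z -> extremal d z = 0.
Proof.
move=> d0 zd; rewrite /extremal.
rewrite (_ : (z == d%:Z) = false); last by apply/eqP; lia.
by rewrite (_ : (z == - d%:Z) = false) ?subr0 //; apply/eqP; lia.
Qed.

Section ProductSpectrum.
Variables (I : finType) (T_ : I -> finType).
Variables (lam : forall i, T_ i -> int) (d : I -> nat).
Arguments lam : clear implicits.
Hypothesis d_gt0 : forall i, (0 < d i)%N.
Hypothesis lam_gap : forall i x, `|lam i x| = (d i)%:Z \/ `|lam i x| *+ 2 <= (d i)%:Z.
Hypothesis sum_lam : forall i, \sum_x lam i x = 0.

Let Lam (f : {dffun forall i, T_ i}) : int := \prod_i lam i (f i).
Let D := (\prod_i d i)%N.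
Let Nu (f : {dffun forall i, T_ i}) : int := \prod_i extremal (d i) (lam i (f i)).

Let DE : D%:Z = \prod_i (d i)%:Z.
Proof. by rewrite /D -[LHS]natz natr_prod; apply: eq_bigr => i _; rewrite natz. Qed.

(** If all factors have full modulus, the product is [D] or [- D] with sign [Nu f]. Otherwise one
    factor loses at least half of its bound, and so does the product. *)
Let Lam_gap f : (Lam f = Nu f * D%:Z /\ `|Nu f| = 1) \/ (Nu f = 0 /\ `|Lam f| *+ 2 <= D%:Z).
Proof.
have [/forallP full|] := boolP [forall i, `|lam i (f i)| == (d i)%:Z].
  left; split.
    rewrite /Lam /Nu DE -big_split; apply: eq_bigr => i _ /=.
    by have [] := extremal_full (d_gt0 i) (eqP (full i)).
  rewrite /Nu normr_prod big1 // => i _.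
  by have [] := extremal_full (d_gt0 i) (eqP (full i)).
rewrite negb_forall => /existsP[i gap]; right; split.
  by rewrite /Nu (bigD1 i) //= extremal_eq0 ?mul0r.
rewrite DE /Lam normr_prod (bigD1 i) // [leRHS](bigD1 i) //= -mulrnAl.
apply: ler_pM; rewrite ?mulrn_wge0 //; first by apply: prodr_ge0.
  by case: (lam_gap (f i)) => // E; rewrite E eqxx in gap.
apply: ler_prod => j _; rewrite normr_ge0 /=.
by case: (lam_gap (f j)) => [->//|]; lia.
Qed.

Let Lam_le f : `|Lam f| <= D%:Z.
Proof.
case: (Lam_gap f) => [[-> Nf]|[_]]; first by rewrite normrM Nf mul1r.
lia.
Qed.

Let sum_Lam (i0 : I) : \sum_f Lam f = 0.
Proof. by rewrite big_dffun_distr (bigD1 i0) //= sum_lam mul0r. Qed.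

(** Here [Lam f - 1] is never positive, and the eigenvalues sum to 0. *)
Lemma sum_shift_prod1 (i0 : I) : D = 1%N ->
  \sum_f `|Lam f + D%:Z - 2| = #|{dffun forall i, T_ i}|%:Z.
Proof.
move=> D1; under eq_bigr => f _.
  have -> : `|Lam f + D%:Z - 2| = 1 - Lam f by have := Lam_le f; lia.
  over.
by rewrite sumrB sum_Lam // subr0 sumr_const -[RHS]natz.
Qed.

(** The shift [D - 2] vanishes, so the sum of absolute values factors over the components. *)
Lemma sum_shift_prod2 : (forall i, \sum_x `|lam i x| = (d i)%:Z *+ 2) -> D = 2%N ->
  \sum_f `|Lam f + D%:Z - 2| = D%:Z *+ 2 ^ #|I|.
Proof.
move=> sum_abs D2; under eq_bigr => f _.
  have -> : `|Lam f + D%:Z - 2| = \prod_i `|lam i (f i)|.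
    by rewrite -normr_prod D2 addrK.
  over.
rewrite (big_dffun_distr (fun i x => `|lam i x|)).
under eq_bigr do rewrite sum_abs -mulr_natr.
by rewrite big_split /= -DE prodr_const -natrX mulr_natr.
Qed.

Lemma sum_shift_prod3 (i0 : I) : (2 < D)%N ->
  \sum_f `|Lam f + D%:Z - 2| = #|{dffun forall i, T_ i}|%:Z * (D%:Z - 2) +
    2 * (\prod_i \sum_x `|extremal (d i) (lam i x)| -
         \prod_i \sum_x extremal (d i) (lam i x)).
Proof.
move=> D2.
(* [Lam f + D - 2] is negative only for [Lam f = - D], because otherwise [Lam f] is at least
   [- D / 2] and an integer. There it equals -2, and the correction [2 * (|Nu f| - Nu f)] is 4;
   elsewhere the correction is 0. *)
rewrite [LHS](eq_bigr (fun f => Lam f + (D%:Z - 2) + 2 * (`|Nu f| - Nu f))) => [|f _]; last first.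
  case: (Lam_gap f) => [[-> Nf]|[->]]; last by lia.
  have [->|->] : Nu f = 1 \/ Nu f = -1 by lia.
    by lia.
  by lia.
rewrite big_split /= [X in X + _]big_split /= sum_Lam // add0r sumr_const; congr (_ + _); first by rewrite -[LHS]mulr_natl natz.
rewrite -mulr_sumr sumrB; congr (_ * (_ - _)); last exact: big_dffun_distr.
rewrite -(big_dffun_distr (fun i x => `|extremal (d i) (lam i x)|)).
by apply: eq_bigr => f _; rewrite /Nu normr_prod.
Qed.
End ProductSpectrum.

(** Tensor products of the diagonalizing bases diagonalize the tensor product. *)
Lemma diagonalizes_prod (I : finType) (T_ : I -> finType)
    (K : forall i, T_ i -> T_ i -> algC) (lam : forall i, T_ i -> int) :
  (forall i, diagonalizes (K i) (lam i)) ->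
  diagonalizes (fun f g : {dffun forall i, T_ i} => \prod_i K i (f i) (g i))
               (fun f => \prod_i lam i (f i)).
Proof.
move=> /fin_all_exists[P] /fin_all_exists[Q PQ].
exists (fun f g : {dffun forall i, T_ i} => \prod_i P i (f i) (g i)).
exists (fun f g : {dffun forall i, T_ i} => \prod_i Q i (f i) (g i)).
split=> f g.
  under eq_bigr do rewrite -big_split /=.
  rewrite (big_dffun_distr (fun i y => P i (f i) y * Q i y (g i))).
  under eq_bigr do rewrite (PQ _).1.
  have [->|/eqP fg] := eqVneq f g; first by rewrite big1 // => i _; rewrite eqxx.
  have [i nfg] : exists i, f i != g i.
    apply/existsP; rewrite -negb_forall; apply: contra_notN fg => /forallP fg.
    by apply/ffunP=> i; apply/eqP.
  by rewrite (bigD1 i) //= (negPf nfg) mul0r.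
under [RHS]eq_bigr do rewrite /= rmorph_prod -!big_split /=.
rewrite (big_dffun_distr (fun i y => P i (f i) y * (lam i y)%:~R * Q i y (g i))).
by apply: eq_bigr => i _; rewrite (PQ _).2.
Qed.

(** * Units and order of a product ring *)

Section ProdRingUnits.
Variables (n : nat) (R_ : 'I_n.+1 -> finComNzRingType).

Lemma prod_ring_unit (f : prod_ring R_) :
  (f \is a GRing.unit) = [forall i, invertible (f i)].
Proof.
apply/unitrP/forallP=> [[g [_ /ffunP fg]] i|/(_ _)/invertibleP H].
  by apply/invertibleP; exists (g i); have := fg i; rewrite !ffunE.
have [g fg] := fin_all_exists H.
have E : f * [ffun i => g i] = 1 by apply/ffunP=> i; rewrite !ffunE fg.
by exists [ffun i => g i]; rewrite mulrC E.
Qed.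

Lemma card_prod_ring : #|(prod_ring R_ : finComUnitRingType)| = (\prod_i #|R_ i|)%N.
Proof.
rewrite -sum1_card.
transitivity (\sum_(f : {dffun forall i, R_ i}) \prod_(i < n.+1) 1%N)%N.
  by apply: eq_bigr => f _; rewrite big1.
rewrite (big_dffun_distr (fun i (x : R_ i) => 1%N)).
by apply: eq_bigr => i _; rewrite -sum1_card.
Qed.

Lemma card_prod_ring_unit :
  #|[set f : prod_ring R_ | f \is a GRing.unit]| =
  (\prod_i #|[set x : R_ i | invertible x]|)%N.
Proof.
rewrite -sum1_card big_mkcond /=.
transitivity (\sum_(f : {dffun forall i, R_ i}) \prod_(i < n.+1) (invertible (f i) : nat))%N.
  apply: eq_bigr => f _; rewrite inE prod_ring_unit.
  have [/forallP H|] := boolP [forall i, invertible (f i)]; first by rewrite big1 // => i _; rewrite H.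
  by rewrite negb_forall => /existsP[i /negPf ni]; rewrite (bigD1 i) //= ni.
rewrite (big_dffun_distr (fun i (x : R_ i) => invertible x : nat)).
by apply: eq_bigr => i _; rewrite -sum1_card [RHS]big_mkcond; apply: eq_bigr => x _; rewrite inE; case: invertible.
Qed.
End ProdRingUnits.

(** * Spectral sums of a local ring *)

Lemma local_spectrum_sums (R : finComNzRingType) (M : {set R}) :
  local_ring_with M ->
  let q := (#|R| %/ #|M|)%N in
  let d := #|[set x : R | invertible x]| in
  exists lam : R -> int,
  [/\ diagonalizes (fun x y : R => (invertible (x - y))%:R) lam,
      (forall x, `|lam x| = d%:Z \/ `|lam x| *+ 2 <= d%:Z),
      \sum_x lam x = 0,
      \sum_x `|lam x| = d%:Z *+ 2
    & \sum_x extremal d (lam x) = (q != 2)%N%:R /\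
      \sum_x `|extremal d (lam x)| = (q == 2)%N.+1%:R].
Proof.
move=> hM q d; have [lam [dl lam3 sl]] := local_spectrum hM; exists lam.
have dE : d = (q.-1 * #|M|)%N by exact: card_local_invertible.
have := local_residue_gt1 hM; have := local_card_gt0 hM; rewrite -/q in lam3 sl *.
move: dE lam3 sl; rewrite -/d; move: #|M| => m dE lam3 sl m0 q1.
rewrite -dE in lam3 sl.
split=> //.
- move=> x; have := lam3 x; rewrite !inE => /or3P[]/eqP ->; first by left; lia.
    have [q2|q2] := eqVneq q 2%N; first by left; rewrite dE q2 /=; lia.
    by right; rewrite dE; nia.
  by right; lia.
- by rewrite (sl id) //; nia.
- by rewrite (sl (fun z => `|z|)) ?normr0 //; nia.
have d0 : (0 < d)%N by rewrite dE; nia.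
have e0 : extremal d 0 = 0 by rewrite extremal_eq0 //; lia.
rewrite (sl (extremal d) e0) (sl (fun z => `|extremal d z|)); last by rewrite e0.
have -> : extremal d d%:Z = 1 by rewrite /extremal eqxx (_ : _ == _ = false) //; apply/eqP; lia.
(* For [q = 2] one has [m = d], so [- m] is extremal with sign -1. For larger [q], [m] is at most
   [d / 2] and only the eigenvalue [d] counts. *)
have [q2|q2] := eqVneq q 2%N.
  have -> : m = d by rewrite dE q2 mul1n.
  have -> : extremal d (- d%:Z) = -1.
    by rewrite /extremal eqxx (_ : - _ == _ = false) //; apply/eqP; lia.
  by rewrite q2.
have -> : extremal d (- m%:Z) = 0 by apply: extremal_eq0 => //; apply/eqP; nia.
by rewrite normr0 !mul0r normr1 addr0.
Qed.

(** * Ring isomorphisms *)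

Lemma ring_iso_sym (A B : nzRingType) : ring_iso A B -> ring_iso B A.
Proof.
case=> f [g fK gK].
pose gA := GRing.isZmodMorphism.Build _ _ g (can2_zmod_morphism fK gK).
pose gM := GRing.isMonoidMorphism.Build _ _ g (can2_monoid_morphism fK gK).
pose G : {rmorphism B -> A} := HB.pack g gA gM.
by exists G; exists f.
Qed.

(** The additive order of 1 divides [p], so [R] is an algebra over ['F_p]. Its structure map is
    injective, as ['F_p] is a field, and bijective by cardinality. *)
Lemma ring_iso_Fp (R : finComNzRingType) (p : nat) :
  prime p -> #|R| = p -> ring_iso R 'F_p.
Proof.
move=> p_pr cardR; apply: ring_iso_sym.
have pcharR : p \in [pchar R].
  rewrite inE p_pr /= -cardR.
  have /eqP := cyclic.expg_cardG (in_setT (1 : R)).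
  by rewrite cardsT FinRing.zmodXgE.
pose f : {rmorphism 'F_p -> pPrimeCharType pcharR} := GRing.in_alg (pPrimeCharType pcharR).
exists f; apply: (@inj_card_bij 'F_p R f (fmorph_inj f)).
by rewrite cardR card_Fp.
Qed.

Lemma ring_iso_prod (n : nat) (R_ S_ : 'I_n.+1 -> finComNzRingType) :
  (forall i, ring_iso (R_ i) (S_ i)) -> ring_iso (prod_ring R_) (prod_ring S_).
Proof.
move=> /fin_all_exists[f f_bij].
have /fin_all_exists[g fg] i : exists g : S_ i -> R_ i, cancel (f i) g /\ cancel g (f i).
  by have [g] := f_bij i; exists g.
pose F (x : prod_ring R_) : prod_ring S_ := [ffun i => f i (x i)].
have FA : zmod_morphism F by move=> x y; apply/ffunP=> i; rewrite !ffunE rmorphB.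
have FM : monoid_morphism F.
  by split=> [|x y]; apply/ffunP=> i; rewrite !ffunE ?rmorph1 ?rmorphM.
pose hA := GRing.isZmodMorphism.Build _ _ F FA.
pose hM := GRing.isMonoidMorphism.Build _ _ F FM.
pose G : {rmorphism prod_ring R_ -> prod_ring S_} := HB.pack F hA hM.
pose F' (y : prod_ring S_) : prod_ring R_ := [ffun i => g i (y i)].
exists G, F' => x; apply/ffunP=> i; rewrite !ffunE.
  by rewrite (fg i).1.
by rewrite (fg i).2.
Qed.

Lemma card_unit_ring_iso (A B : finComUnitRingType) : ring_iso A B ->
  #|[set x : A | x \is a GRing.unit]| = #|[set x : B | x \is a GRing.unit]|.
Proof.
case=> f [g fK gK]; rewrite -(card_imset _ (can_inj fK)); apply: eq_card => y.
rewrite inE; apply/imsetP/idP=> [[x]|/unitrP[z [zy yz]]].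
  by rewrite inE => ux ->; rewrite rmorph_unit.
exists (g y) => //; rewrite inE; apply/unitrP; exists (g z).
by split; apply: (can_inj fK); rewrite rmorphM rmorph1 !gK.
Qed.

Lemma card_invertible_Fp (p : nat) : prime p -> #|[set x : 'F_p | invertible x]| = p.-1.
Proof.
move=> p_pr; rewrite -[in RHS](card_Fp p_pr) -(cardsC1 (0 : 'F_p)).
apply: eq_card => x; rewrite !inE; apply/invertibleP/idP=> [[y xy]|x0].
  by apply: contra_eq_neq xy => ->; rewrite mul0r eq_sym oner_neq0.
by exists x^-1; rewrite mulfV.
Qed.

(** Only the factor ['F_3] has more than one unit. An isomorphism with [F2s_F3 n] thus forces degree
    2. *)
Lemma card_unit_F2s_F3 (n : nat) : #|[set x : F2s_F3 n | x \is a GRing.unit]| = 2%N.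
Proof.
rewrite card_prod_ring_unit (bigD1 ord_max) //= eqxx card_invertible_Fp //=.
rewrite big1 // => i /negPf ->; by rewrite card_invertible_Fp.
Qed.

Lemma ring_iso_F2s_F3 (n : nat) (R_ : 'I_n.+1 -> finComNzRingType) :
  (forall i, #|R_ i| = if i == ord_max then 3%N else 2%N) ->
  ring_iso (prod_ring R_) (F2s_F3 n).
Proof.
move=> cardR; apply: ring_iso_prod => i.
by have := cardR i; case: (i == ord_max) => ?; apply: ring_iso_Fp.
Qed.

Lemma ring_iso_prod1 (R_ : 'I_1 -> finComNzRingType) : ring_iso (prod_ring R_) (R_ ord0).
Proof.
pose F (x : prod_ring R_) : R_ ord0 := x ord0.
have FA : zmod_morphism F by move=> x y; rewrite /F !ffunE.
have FM : monoid_morphism F by split=> [|x y]; rewrite /F !ffunE.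
pose hA := GRing.isZmodMorphism.Build _ _ F FA.
pose hM := GRing.isMonoidMorphism.Build _ _ F FM.
pose G : {rmorphism prod_ring R_ -> R_ ord0} := HB.pack F hA hM.
exists G; apply: inj_card_bij; last by rewrite card_prod_ring big_ord1.
by move=> x y xy; apply/ffunP=> i; rewrite ord1.
Qed.

Lemma ring_iso_trans (A B C : nzRingType) : ring_iso A B -> ring_iso B C -> ring_iso A C.
Proof. by move=> [f fb] [g gb]; exists (g \o f : {rmorphism A -> C}); exact: bij_comp. Qed.

Lemma ring_iso_prod_F3 (n : nat) (R_ : 'I_n.+1 -> finComNzRingType) :
  ord0 = ord_max :> 'I_n.+1 -> #|R_ ord0| = 3%N -> ring_iso (prod_ring R_) 'F_3.
Proof.
move=> /(congr1 val) /= n0; subst n => cardR.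
exact: ring_iso_trans (ring_iso_prod1 R_) (ring_iso_Fp _ cardR).
Qed.

(** * Energy of the line graph *)

Section CayleyGraph.
Variable R : finComUnitRingType.

Lemma unitary_cayley_graph_sym : symmetric (unitary_cayley_graph R).
Proof. by move=> x y; rewrite /unitary_cayley_graph -unitrN opprB. Qed.

Lemma unitary_cayley_graph_irr : irreflexive (unitary_cayley_graph R).
Proof. by move=> x; rewrite /unitary_cayley_graph subrr unitr0. Qed.

Lemma unitary_cayley_graph_reg x :
  #|[set y | unitary_cayley_graph R x y]| = #|[set y : R | y \is a GRing.unit]|.
Proof.
rewrite -(card_imset [set y : R | y \is a GRing.unit] (inv_inj (subKr x))).
apply: eq_card => y; rewrite inE; apply/idP/imsetP=> [uxy|[z]].
  by exists (x - y); rewrite ?inE // subKr.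
by rewrite inE => uz ->; rewrite /unitary_cayley_graph subKr.
Qed.
End CayleyGraph.

Section LocalProduct.
Variables (n : nat) (R_ : 'I_n.+1 -> finComNzRingType).
Variable M : forall i : 'I_n.+1, {set R_ i}.
Hypothesis M_local : forall i, local_ring_with (M i).

Let R : finComUnitRingType := prod_ring R_.
Let q i := (#|R_ i| %/ #|M i|)%N.
Let d i := #|[set x : R_ i | invertible x]|.
Let D := (\prod_i d i)%N.
Let E : algC := energy (line_graph (unitary_cayley_graph R)).

(** For [D > 2], the first product counts the eigenvalues [D] and [- D] together, and the second is
    the multiplicity of [D] minus that of [- D]. Their difference is twice the multiplicity of
    [- D]. *)
Lemma energy_local_product :
  [/\ D = 1%N -> E = 0,
      D = 2%N -> E = 2 ^+ n.+2
    & (2 < D)%N -> E = 2 * #|R|%:R * (D%:R - 2) +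
        2 * ((\prod_i (q i == 2).+1)%N%:R - (\prod_i (q i != 2))%N%:R)].
Proof.
have /fin_all_exists[lam lamP] := fun i => local_spectrum_sums (M_local i).
pose Lam (f : R) : int := \prod_i lam i (f i).
have d_gt0 i : (0 < d i)%N.
  by apply/card_gt0P; exists 1; rewrite inE; apply/invertibleP; exists 1; rewrite mulr1.
have gap i x : `|lam i x| = (d i)%:Z \/ `|lam i x| *+ 2 <= (d i)%:Z by have [] := lamP i.
have sum0 i : \sum_x lam i x = 0 by have [] := lamP i.
have sumabs i : \sum_x `|lam i x| = (d i)%:Z *+ 2 by have [] := lamP i.
have diag : diagonalizes (fun f g => (unitary_cayley_graph R f g)%:R) Lam.
  (* The product of the component indicators is the indicator of a unit, so the tensor product
     kernel is the adjacency of the Cayley graph. *)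
  have := @diagonalizes_prod _ R_ (fun i x y => (invertible (x - y))%:R) lam
    (fun i => let: And5 h _ _ _ _ := lamP i in h).
  case=> P [Q [PQ KE]]; exists P, Q; split=> // f g; rewrite -KE.
  rewrite /unitary_cayley_graph prod_ring_unit.
  have [/forallP H|] := boolP [forall i, invertible ((f - g) i)].
    by rewrite big1 // => i _; have := H i; rewrite !ffunE => ->.
  rewrite negb_forall => /existsP[i]; rewrite !ffunE => /negPf ni.
  by rewrite (bigD1 i) //= ni mul0r.
have reg x : #|[set y | unitary_cayley_graph R x y]| = D.
  by rewrite unitary_cayley_graph_reg card_prod_ring_unit.
have := energy_line_graph (@unitary_cayley_graph_sym R)
  (@unitary_cayley_graph_irr R) reg diag; rewrite -/E => ->.
split=> [D1|D2|D3].
- rewrite (sum_shift_prod1 d_gt0 gap sum0 ord0 D1) D1; apply/eqP.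
  by rewrite intr_eq0 (_ : 1%N%:Z - 2 = -1) // mulrN1 subrr.
- have := sum_shift_prod2 (lam := lam) sumabs D2; rewrite -/D D2 => ->.
  rewrite subrr mulr0 addr0 card_ord.
  have -> : 2%:Z *+ 2 ^ n.+1 = (2 ^ n.+2)%N%:Z by rewrite -[LHS]mulr_natr natz [in RHS]expnS PoszM.
  by rewrite -natrX.
- have := sum_shift_prod3 d_gt0 gap sum0 ord0 D3; rewrite -/D => ->.
  have -> : \prod_i \sum_x `|extremal (d i) (lam i x)| = (\prod_i (q i == 2).+1)%N%:Z.
    rewrite -[RHS]natz natr_prod.
    by apply: eq_bigr => i _; have [_ _ _ _ []] := lamP i.
  have -> : \prod_i \sum_x extremal (d i) (lam i x) = (\prod_i (q i != 2))%N%:Z.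
    rewrite -[RHS]natz natr_prod.
    by apply: eq_bigr => i _; have [_ _ _ _ []] := lamP i.
  rewrite !intrD !intrM !intrB -!pmulrn; ring.
Qed.

End LocalProduct.

(** * The three cases of the energy formula *)

Theorem theorem5p1 (n : nat) (R_ : 'I_n.+1 -> finComNzRingType)
    (M : forall i : 'I_n.+1, {set R_ i})
    (hloc : forall i : 'I_n.+1, local_ring_with (M i))
    (hsort : forall i j : 'I_n.+1, (i <= j)%N ->
       (#|R_ i| %/ #|M i| <= #|R_ j| %/ #|M j|)%N) :
  let s := n.+1 in
  let R : finComUnitRingType := prod_ring R_ in
  let q := fun i : 'I_n.+1 => (#|R_ i| %/ #|M i|)%N in
  let u : algC := #|[set x : R | x \is a GRing.unit]|%:R in
  let E : algC := energy (line_graph (unitary_cayley_graph R)) in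
  [/\ (forall i : 'I_n.+1, q i = 2%N) \/ ring_iso R (F2s_F3 n) ->
        E = 2 ^+ s.+1 * (u - 1) ^+ 2,
      forall t : 'I_n.+1, (1 <= t)%N ->
        (forall i : 'I_n.+1, (i < t)%N -> q i = 2%N) -> (2 < q t)%N ->
        ~ ring_iso R (F2s_F3 n) ->
        E = 2 ^+ t.+1 + 2 * #|R|%:R * (u - 2)
    & (3 <= q ord0)%N -> ~ ring_iso R 'F_3 ->
        E = 2 * #|R|%:R * (u - 2)].
Proof.
move=> s R q u E.
have [E1 E2 E3] := energy_local_product hloc; rewrite -/R -/E in E1 E2 E3.
pose d i := #|[set x : R_ i | invertible x]|.
pose D := (\prod_i d i)%N; rewrite -/D -/q in E1 E2 E3.
have uE : u = D%:R by rewrite /u card_prod_ring_unit.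
have dE i : d i = ((q i).-1 * #|M i|)%N by exact: card_local_invertible.
have m_gt0 i : (0 < #|M i|)%N := local_card_gt0 (hloc i).
have q_gt1 i : (1 < q i)%N := local_residue_gt1 (hloc i).
have cardR i : #|R_ i| = (q i * #|M i|)%N := local_card (hloc i).
have d_gt0 i : (0 < d i)%N by rewrite dE muln_gt0 m_gt0 -ltnS prednK ?q_gt1 // ltnW.
have D_gt0 : (0 < D)%N by exact: prodn_gt0.
(* A factor with [q >= 3] already has two units, so the others have only one. *)
have small t : (2 < q t)%N -> (D <= 2)%N ->
    t = ord_max /\ forall i, #|R_ i| = if i == ord_max then 3%N else 2%N.
  move=> qt D2.
  have Dt : D = (d t * \prod_(i | i != t) d i)%N by rewrite /D (bigD1 t).
  have P_gt0 : (0 < \prod_(i | i != t) d i)%N by exact: prodn_gt0.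
  have dt : d t = 2%N by have := dE t; have := m_gt0 t; nia.
  have di i : i != t -> d i = 1%N.
    move=> it; have Pi : (\prod_(j | j != t) d j = d i * \prod_(j | (j != t) && (j != i)) d j)%N.
      by rewrite (bigD1 i).
    have : (0 < \prod_(j | (j != t) && (j != i)) d j)%N by exact: prodn_gt0.
    by have := d_gt0 i; nia.
  (* Every other factor has [(q i - 1) * #|M i| = 1], hence [q i = 2 < q t]; the ordering then
     leaves only the last place for [t]. *)
  have tmax : t = ord_max.
    apply/eqP; apply: contraT => tm.
    have := di ord_max; rewrite eq_sym => /(_ tm); rewrite dE.
    have := hsort t ord_max (leq_ord t); rewrite -/(q t) -/(q ord_max).
    have := m_gt0 ord_max; nia.
  split=> // i; rewrite cardR -tmax; case: eqVneq => [->|/di].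
    by have := dE t; have := m_gt0 t; nia.
  by rewrite dE; have := m_gt0 i; have := q_gt1 i; nia.
split.
- case=> [q2|iso].
    have N : #|R| = (2 ^ n.+1 * D)%N.
      have -> : (2 ^ n.+1 = \prod_(i < n.+1) 2)%N by rewrite prod_nat_const card_ord.
      rewrite card_prod_ring -big_split.
      by apply: eq_bigr => i _; rewrite cardR dE q2 /= mul1n.
    case: (ltngtP D 2) => [D1|D3|D2].
    - have {}D1 : D = 1%N by lia.
      by rewrite E1 // uE D1 subrr expr0n mulr0.
    (* Since [#|R| = 2^s D], the energy is [2^(s+1) D (D - 2) + 2^(s+1)], which is
       [2^(s+1) (D - 1)^2]. *)
    - rewrite E3 // uE N natrM natrX.
      have -> : (\prod_i (q i == 2).+1 = 2 ^ n.+1)%N.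
        by under eq_bigr do rewrite q2; rewrite prod_nat_const card_ord.
      have -> : (\prod_i (q i != 2) = 0)%N by rewrite (bigD1 ord0) //= q2.
      by rewrite natrX /s [2 ^+ n.+2]exprS; ring.
    - by rewrite E2 // uE D2 (_ : 2%:R - 1 = 1) ?expr1n ?mulr1 //; ring.
  have D2 : D = 2%N by rewrite /D -card_prod_ring_unit (card_unit_ring_iso iso) card_unit_F2s_F3.
  by rewrite E2 // uE D2 (_ : 2%:R - 1 = 1) ?expr1n ?mulr1 //; ring.
- move=> t t1 qlt qt niso.
  have D3 : (2 < D)%N.
    by rewrite ltnNge; apply/negP => /(small t qt)[_ /ring_iso_F2s_F3].
  rewrite E3 // uE addrC; congr (_ + _).
  (* Indices start at 0, so [t] is both the first index with [q t > 2] and the number of factors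
     with residue field of order 2. *)
  have qge (i : 'I_n.+1) : (t <= i)%N -> (2 < q i)%N by move=> /(hsort t i); exact: leq_trans.
  have -> : (\prod_i (q i != 2) = 0)%N.
    by rewrite (bigD1 ord0) //= qlt.
  have -> : (\prod_i (q i == 2).+1 = 2 ^ t)%N.
    have -> : (2 ^ t = \prod_(i < t) 2)%N by rewrite prod_nat_const card_ord.
    rewrite (big_ord_widen n.+1 (fun=> 2%N)) ?(ltnW (ltn_ord t)) // [RHS]big_mkcond.
    by apply: eq_bigr => i _; case: ltnP => [/qlt ->//|/qge]; case: eqP => // ->.
  by rewrite natrX exprS subr0.
- move=> q0 niso.
  have D3 : (2 < D)%N.
    (* If [D] were at most 2, the first factor would also be the last one and have 3 elements,
       making [R] isomorphic to ['F_3]. *)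
    rewrite ltnNge; apply/negP => /(small ord0 q0)[n0 cR]; apply: niso.
    by apply: ring_iso_prod_F3 => //; rewrite cR n0 eqxx.
  have q2 i : (q i == 2) = false.
    by apply/eqP => qi; have := leq_trans q0 (hsort ord0 i (leq0n i)); rewrite -/(q i) qi.
  rewrite E3 // uE.
  (* Both products are 1: [- D] is not an eigenvalue and the correction vanishes. *)
  have -> : (\prod_i (q i == 2).+1 = 1)%N by rewrite big1 // => i _; rewrite q2.
  have -> : (\prod_i (q i != 2) = 1)%N by rewrite big1 // => i _; rewrite q2.
  by rewrite subrr mulr0 addr0.
Qed.
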